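(* Suppose that the program (FLAT-SOCP) described in the context has a feasible solution $\boldsymbol{P}_0,\dots,\boldsymbol{P}_N$ (together with some $\boldsymbol{\zeta}$). Let $\boldsymbol{r}(t)$ be the B-spline curve defined by the control points $\boldsymbol{P}_0,\dots,\boldsymbol{P}_N$. Then the quadcopter state trajectory $\boldsymbol{x}(t)$ and input trajectory $\boldsymbol{u}(t)$ obtained from the flat map with flat output $\boldsymbol{\sigma}(t)=(\boldsymbol{r}(t),0)$ (i.e. yaw $\psi(t)\equiv 0$) satisfy, for all $t\in[\tau_0,\tau_v)$, $$\boldsymbol{x}(t)\in\mathcal{X}_p\cap\mathcal{X}_v\cap\mathcal{X}_\xi,\qquad \boldsymbol{u}(t)\in\mathcal{U}_T\cap\mathcal{U}_\omega .$$
   Context: **B-splines.** Fix integers $d\ge 4$, $N\ge d$, $v=N+d+1$, and a knot vector $\tau_0\le\dots\le\tau_v$ with $\tau_0<\tau_v$ that is clamped ($\tau_0=\dots=\tau_d$, $\tau_{v-d}=\dots=\tau_v$) and uniform ($\tau_{d+1}-\tau_d=\dots=\tau_{N+1}-\tau_N$). Basis functions: $\lambda_{i,0}(t)=1$ if $\tau_i\le t<\tau_{i+1}$ and $0$ otherwise; $\lambda_{i,k}(t)=\frac{t-\tau_i}{\tau_{i+k}-\tau_i}\lambda_{i,k-1}(t)+\frac{\tau_{i+k+1}-t}{\tau_{i+k+1}-\tau_{i+1}}\lambda_{i+1,k-1}(t)$ (terms with zero denominator are $0$; values at $t=\tau_v$ are left limits). $\boldsymbol{\Lambda}_{d-r}(t)=(\lambda_{0,d-r}(t),\dots,\lambda_{N+r,d-r}(t))^T$.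 For control points $\boldsymbol{P}_0,\dots,\boldsymbol{P}_N\in\mathbb{R}^3$ and $P=[\boldsymbol{P}_0\cdots\boldsymbol{P}_N]$, the B-spline curve $\boldsymbol{r}(t)$ and its derivatives are $\boldsymbol{r}^{(r)}(t)=PB_r\boldsymbol{\Lambda}_{d-r}(t)$, $0\le r\le d$. Here $B_r=M_{d,d-r}C_r\in\mathbb{R}^{(N+1)\times(N+r+1)}$; $M_{d,d}=I_{N+1}$ and, for $1\le r\le d$, $M_{d,d-r}=F_1F_2\cdots F_r$, with $F_i\in\mathbb{R}^{(N-i+2)\times(N-i+1)}$ having in column number $k+1$ ($k=0,\dots,N-i$) the entry $-a_k$ in row $k+1$, $a_k$ in row $k+2$ and zeros elsewhere, $a_k=\frac{d-i+1}{\tau_{k+d+1}-\tau_{k+i}}$; $C_r=[0_{(N+1-r)\times r}\ I_{N+1-r}\ 0_{(N+1-r)\times r}]$, $C_0=I_{N+1}$. $b_{r,i,j}$ is the $(i,j)$ entry (1-based) of $B_r$, and $\boldsymbol{b}_{r,j}^T$ is its $j$-th row. **Quadcopter flat map.** $g>0$ is the gravitational acceleration, $\boldsymbol{z}_W=(0,0,1)^T$. For a position trajectory $\boldsymbol{r}=(x,y,z)^T$ and yaw $\psi$, put $\boldsymbol{T}=(\ddot x,\ddot y,\ddot z+g)^T$, $\boldsymbol{y}_C=(-\sin\psi,\cos\psi,0)^T$, $\boldsymbol{z}_B=\boldsymbol{T}/\|\boldsymbol{T}\|_2$, $\boldsymbol{x}_B=\frac{\boldsymbol{y}_C\times\boldsymbol{z}_B}{\|\boldsymbol{y}_C\times\boldsymbol{z}_B\|_2}$,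 $\boldsymbol{y}_B=\boldsymbol{z}_B\times\boldsymbol{x}_B$, $\boldsymbol{h}_\omega=\frac{1}{\|\boldsymbol{T}\|_2}\big(\dddot{\boldsymbol{r}}-(\boldsymbol{z}_B\cdot\dddot{\boldsymbol{r}})\boldsymbol{z}_B\big)$. The flat map gives pitch $\theta=-\sin^{-1}(\boldsymbol{z}_W^T\boldsymbol{x}_B)$, roll $\phi=\sin^{-1}\!\Big(\frac{\boldsymbol{z}_W^T\boldsymbol{y}_B}{\cos(\sin^{-1}(\boldsymbol{z}_W^T\boldsymbol{x}_B))}\Big)$, normalized thrust $T=\sqrt{\ddot x^2+\ddot y^2+(\ddot z+g)^2}$, body rates $p=-\boldsymbol{y}_B\cdot\boldsymbol{h}_\omega$, $q=\boldsymbol{x}_B\cdot\boldsymbol{h}_\omega$, $\omega_3=\boldsymbol{z}_B\cdot\dot\psi\,\boldsymbol{z}_W$. State $\boldsymbol{x}=(x,y,z,\phi,\theta,\psi,\dot x,\dot y,\dot z)^T$, input $\boldsymbol{u}=(T,p,q,\omega_3)^T$. **Safety sets.** Given a second-order cone set $\mathcal{K}_p=\{\boldsymbol{p}\in\mathbb{R}^3:\|A\boldsymbol{p}+\boldsymbol{b}\|_2\le\boldsymbol{c}^T\boldsymbol{p}+e\}$ and constants $\overline v\ge0$, $0<\epsilon<\pi/2$, $0\le\underline T\le g\le\overline T$, $\overline\omega> 0$: $\mathcal{X}_p=\{\boldsymbol{x}:\boldsymbol{r}\in\mathcal{K}_p\}$, $\mathcal{X}_v=\{\boldsymbol{x}:\|\dot{\boldsymbol{r}}\|_2\le\overline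 v\}$, $\mathcal{X}_\xi=\{\boldsymbol{x}:|\phi|,|\theta|\le\epsilon\}$, $\mathcal{U}_T=\{\boldsymbol{u}:\underline T\le T\le\overline T\}$, $\mathcal{U}_\omega=\{\boldsymbol{u}:|p|,|q|\le\overline\omega\}$. Let $A_\epsilon=|\cot\epsilon|\,\mathrm{diag}(1,1,0)$. **(FLAT-SOCP).** Decision variables: $\boldsymbol{P}_0,\dots,\boldsymbol{P}_N\in\mathbb{R}^3$ and $\boldsymbol{\zeta}=(\zeta_1,\dots,\zeta_{N-d+1})$ with positive entries. Minimize $\int_{\tau_0}^{\tau_v}\|\boldsymbol{r}^{(4)}(t)\|_2^2\,dt-\sum_{k=1}^{N-d+1}\zeta_k$ subject to: - (position) $\boldsymbol{P}_j\in\mathcal{K}_p$, $j=0,\dots,N$; - (velocity) $\|\sum_{i=0}^N\boldsymbol{P}_ib_{1,i+1,j+1}\|_2\le\overline v$, $j=1,\dots,N$; - (angles) $\|A_\epsilon\sum_{i=0}^N\boldsymbol{P}_ib_{2,i+1,j+1}\|_2\le g+\sum_{i=0}^N\boldsymbol{z}_W^T\boldsymbol{P}_ib_{2,i+1,j+1}$, $j=2,\dots,N$; - (thrust) $\|\sum_{i=0}^N\boldsymbol{P}_ib_{2,i+1,j+1}+g\boldsymbol{z}_W\|_2\le\overline T$ and $\sum_{i=0}^N\boldsymbol{z}_W^T\boldsymbol{P}_ib_{2,i+1,j+1}\ge\underline T-g$, $j=2,\dots,N$; - (angular velocity) for each $l=d,\dots,N$: $\sum_{i=0}^N\boldsymbol{z}_W^T\boldsymbol{P}_ib_{2,i+1,j+1}\ge\zeta_{l-d+1}-g$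 for $j=l-d+2,\dots,l$, and $\|\sum_{i=0}^N\boldsymbol{P}_ib_{3,i+1,j+1}\|_2\le\overline\omega\,\zeta_{l-d+1}$ for $j=l-d+3,\dots,l$; - (waypoints) $\|\sum_{j=0}^N\boldsymbol{P}_j\lambda_{j,d}(t_i)-\boldsymbol{p}^{wp}_i\|_2\le d_{wp}$, $i=1,\dots,n_{wp}$, for given times $t_i$, points $\boldsymbol{p}_i^{wp}\in\mathbb{R}^3$ and $d_{wp}\ge0$; - (initial/final conditions) $\sum_{i=0}^N\boldsymbol{P}_i\boldsymbol{b}_{r,i+1}^T\boldsymbol{\Lambda}_{d-r}(t_m)=\boldsymbol{p}^m_r$, $r=0,\dots,n_m$, $m\in\{0,f\}$, where $t_0=\tau_0$, $t_f=\tau_v$, $0\le n_0,n_f\le d$ and $\boldsymbol{p}^m_r\in\mathbb{R}^3$ are given. A feasible solution is a choice of the variables satisfying all the constraints. *)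

(* Defs.v *)
From HB Require Import structures.
From mathcomp Require Import all_boot all_order all_algebra.
From mathcomp Require Import all_classical all_reals all_analysis.

Set Implicit Arguments.
Unset Strict Implicit.
Unset Printing Implicit Defensive.

Import Order.TTheory GRing.Theory Num.Theory.
Import numFieldNormedType.Exports.

Local Open Scope classical_set_scope.
Local Open Scope ring_scope.

Section Euclidean.
Variable R : realType.

(* The library norm on matrices is the sup norm, hence this definition. *)
Definition norm2 n (u : 'cV[R]_n) : R := Num.sqrt (\sum_i u i 0 ^+ 2).

Definition dotp n (u w : 'cV[R]_n) : R := \sum_i u i 0 * w i 0.

Definition vec3 (a b c : R) : 'cV[R]_3 := \col_(i < 3) [:: a; b; c]`_i.

Definition crossp (u w : 'cV[R]_3) : 'cV[R]_3 :=
  vec3 (u 1 0 * w 2%:R 0 - u 2%:R 0 * w 1 0)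
       (u 2%:R 0 * w 0 0 - u 0 0 * w 2%:R 0)
       (u 0 0 * w 1 0 - u 1 0 * w 0 0).

Definition zW : 'cV[R]_3 := vec3 0 0 1.

Definition cot (x : R) : R := cos x / sin x.

End Euclidean.

(* Derivative of f relative to the time domain J: for J = [a, b[ it is the
   ordinary two-sided derivative on ]a, b[ and the right derivative at a. *)
Definition deriv_on (R : realType) (V : normedModType R) (J : set R)
    (f : R -> V) (t : R) : V :=
  lim ((s - t)^-1 *: (f s - f t) @[s --> within J t^']).

Section BSpline.
Variables (R : realType) (d N : nat).
(* Only the values tau 0, ..., tau (N + d + 1) are ever used. *)
Variable tau : nat -> R.

Definition last_knot : nat := (N + d + 1)%N.

Record clamped_uniform : Prop := ClampedUniform {
  knots_le : forall i, (i < last_knot)%N -> tau i <= tau i.+1;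
  knots_lt : tau 0%N < tau last_knot;
  knots_clamped_left : forall i, (i <= d)%N -> tau i = tau 0%N;
  knots_clamped_right : forall i, (last_knot - d <= i <= last_knot)%N ->
    tau i = tau last_knot;
  knots_uniform : forall i, (d <= i <= N)%N ->
    tau i.+1 - tau i = tau d.+1 - tau d }.

(* As x / 0 = 0, terms with a zero denominator vanish. *)
Fixpoint cox_de_boor (i k : nat) (t : R) : R :=
  match k with
  | 0 => if tau i <= t < tau i.+1 then 1 else 0
  | k'.+1 =>
      (t - tau i) / (tau (i + k)%N - tau i) * cox_de_boor i k' t
      + (tau (i + k).+1 - t) / (tau (i + k).+1 - tau i.+1)
        * cox_de_boor i.+1 k' t
  end.

Definition lambda (i k : nat) (t : R) : R :=
  if t == tau last_knot then lim (cox_de_boor i k s @[s --> t^'-])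
  else cox_de_boor i k t.

(* The vector Lambda_{d-r}. *)
Definition Lambda (r : nat) (t : R) : 'cV[R]_(N.+1 + r) :=
  \col_j lambda j (d - r) t.

Definition aco (i k : nat) : R := (d - i + 1)%:R / (tau (k + d + 1)%N - tau (k + i)%N).

Definition Fmx (i : nat) : 'M[R]_(N.+2 - i, N.+1 - i) :=
  \matrix_(l, k) if l == k :> nat then - aco i k
                 else if l == k.+1 :> nat then aco i k else 0.

(* Mmx r is M_{d,d-r} = F_1 ... F_r. *)
Fixpoint Mmx (r : nat) : 'M[R]_(N.+1, N.+1 - r) :=
  match r with
  | 0 => 1%:M
  | r'.+1 => Mmx r' *m Fmx r'.+1
  end.

(* C_r = [0 I 0], the zero blocks having r columns each. *)
Definition Cmx (r : nat) : 'M[R]_(N.+1 - r, N.+1 + r) :=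
  \matrix_(k, j) (j == (r + k)%N :> nat)%:R.

Definition Bmx (r : nat) : 'M[R]_(N.+1, N.+1 + r) := Mmx r *m Cmx r.

(* Control points are the columns P_i = col i P of P. *)
Definition bspline_curve (P : 'M[R]_(3, N.+1)) (t : R) : 'cV[R]_3 :=
  P *m Bmx 0 *m Lambda 0 t.

End BSpline.

Record quad_state (R : realType) := QuadState {
  st_pos : 'cV[R]_3;
  st_roll : R;
  st_pitch : R;
  st_yaw : R;
  st_vel : 'cV[R]_3 }.

Record quad_input (R : realType) := QuadInput {
  in_thrust : R;
  in_p : R;
  in_q : R;
  in_omega3 : R }.

Section FlatMap.
Variables (R : realType) (J : set R) (g : R) (sigma : R -> 'cV[R]_3 * R).

Let r (t : R) : 'cV[R]_3 := (sigma t).1.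
Let psi (t : R) : R := (sigma t).2.
Let r1 : R -> 'cV[R]_3 := deriv_on J r.
Let r2 : R -> 'cV[R]_3 := deriv_on J r1.
Let r3 : R -> 'cV[R]_3 := deriv_on J r2.

Definition Tvec (t : R) : 'cV[R]_3 := r2 t + g *: zW R.
Definition yC (t : R) : 'cV[R]_3 := vec3 (- sin (psi t)) (cos (psi t)) 0.
Definition zB (t : R) : 'cV[R]_3 := (norm2 (Tvec t))^-1 *: Tvec t.
Definition xB (t : R) : 'cV[R]_3 :=
  (norm2 (crossp (yC t) (zB t)))^-1 *: crossp (yC t) (zB t).
Definition yB (t : R) : 'cV[R]_3 := crossp (zB t) (xB t).
Definition homega (t : R) : 'cV[R]_3 :=
  (norm2 (Tvec t))^-1 *: (r3 t - dotp (zB t) (r3 t) *: zB t).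

Definition flat_state (t : R) : quad_state R :=
  {| st_pos := r t;
     st_roll := asin (dotp (zW R) (yB t) / cos (asin (dotp (zW R) (xB t))));
     st_pitch := - asin (dotp (zW R) (xB t));
     st_yaw := psi t;
     st_vel := r1 t |}.

Definition flat_input (t : R) : quad_input R :=
  {| in_thrust := Num.sqrt (r2 t 0 0 ^+ 2 + r2 t 1 0 ^+ 2
                            + (r2 t 2%:R 0 + g) ^+ 2);
     in_p := - dotp (yB t) (homega t);
     in_q := dotp (xB t) (homega t);
     in_omega3 := dotp (zB t) (deriv_on J psi t *: zW R) |}.

End FlatMap.

Record flat_data (R : realType) := FlatData {
  grav : R;
  soc_dim : nat;
  soc_A : 'M[R]_(soc_dim, 3);
  soc_b : 'cV[R]_soc_dim;
  soc_c : 'cV[R]_3;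
  soc_e : R;
  vmax : R;
  eps : R;
  Tmin : R;
  Tmax : R;
  wmax : R;
  nwp : nat;
  twp : 'I_nwp -> R;
  pwp : 'I_nwp -> 'cV[R]_3;
  dwp : R;
  n0 : nat;
  nf : nat;
  p0 : nat -> 'cV[R]_3;
  pf : nat -> 'cV[R]_3 }.

Record flat_data_ok (R : realType) (d : nat) (D : flat_data R) : Prop :=
  FlatDataOk {
  grav_gt0 : 0 < grav D;
  vmax_ge0 : 0 <= vmax D;
  eps_gt0 : 0 < eps D;
  eps_lt : eps D < pi / 2;
  Tmin_ge0 : 0 <= Tmin D;
  Tmin_le : Tmin D <= grav D;
  Tmax_ge : grav D <= Tmax D;
  wmax_gt0 : 0 < wmax D;
  dwp_ge0 : 0 <= dwp D;
  n0_le : (n0 D <= d)%N;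
  nf_le : (nf D <= d)%N }.

Section SafetySets.
Variables (R : realType) (D : flat_data R).

Definition Kp : set 'cV[R]_3 :=
  [set p | norm2 (soc_A D *m p + soc_b D) <= dotp (soc_c D) p + soc_e D].

Definition Xp : set (quad_state R) := [set x | Kp (st_pos x)].
Definition Xv : set (quad_state R) := [set x | norm2 (st_vel x) <= vmax D].
Definition Xxi : set (quad_state R) :=
  [set x | `|st_roll x| <= eps D /\ `|st_pitch x| <= eps D].
Definition UT : set (quad_input R) :=
  [set u | Tmin D <= in_thrust u <= Tmax D].
Definition Uomega : set (quad_input R) :=
  [set u | `|in_p u| <= wmax D /\ `|in_q u| <= wmax D].

Definition Aeps : 'M[R]_3 := `|cot (eps D)| *: diag_mx (vec3 1 1 0)^T.

End SafetySets.

Section FlatSOCP.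
Variables (R : realType) (d N : nat) (tau : nat -> R) (D : flat_data R).
Variables (P : 'M[R]_(3, N.+1)) (zeta : 'rV[R]_(N - d).+1).

Let v : nat := last_knot d N.

(* Column index j is 0-based, so entry (i, j) of Bmx is b_{r,i+1,j+1}. *)
Definition ctrl (r : nat) (j : 'I_(N.+1 + r)) : 'cV[R]_3 :=
  \sum_(i < N.+1) Bmx d N tau r i j *: col i P.
Definition zctrl (r : nat) (j : 'I_(N.+1 + r)) : R :=
  \sum_(i < N.+1) dotp (zW R) (col i P) * Bmx d N tau r i j.

Definition end_deriv (r : nat) (t : R) : 'cV[R]_3 :=
  \sum_(i < N.+1) (row i (Bmx d N tau r) *m Lambda d N tau r t) 0 0 *: col i P.

(* In the angular velocity constraints, zeta 0 (inord (l - d)) is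
   zeta_{l-d+1}. *)
Record flat_socp_feasible : Prop := FlatSocpFeasible {
  zeta_gt0 : forall k, 0 < zeta 0 k;
  position_con : forall j : 'I_N.+1, Kp D (col j P);
  velocity_con : forall j : 'I_(N.+1 + 1), (1 <= j <= N)%N ->
    norm2 (ctrl j) <= vmax D;
  angle_con : forall j : 'I_(N.+1 + 2), (2 <= j <= N)%N ->
    norm2 (Aeps D *m ctrl j) <= grav D + zctrl j;
  thrust_max_con : forall j : 'I_(N.+1 + 2), (2 <= j <= N)%N ->
    norm2 (ctrl j + grav D *: zW R) <= Tmax D;
  thrust_min_con : forall j : 'I_(N.+1 + 2), (2 <= j <= N)%N ->
    zctrl j >= Tmin D - grav D;
  omega_acc_con : forall l, (d <= l <= N)%N ->
    forall j : 'I_(N.+1 + 2), (l - d + 2 <= j <= l)%N ->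
    zctrl j >= zeta 0 (inord (l - d)) - grav D;
  omega_jerk_con : forall l, (d <= l <= N)%N ->
    forall j : 'I_(N.+1 + 3), (l - d + 3 <= j <= l)%N ->
    norm2 (ctrl j) <= wmax D * zeta 0 (inord (l - d));
  waypoint_con : forall i : 'I_(nwp D),
    norm2 (\sum_(j < N.+1) lambda d N tau j d (twp i) *: col j P - pwp i)
      <= dwp D;
  initial_con : forall r, (r <= n0 D)%N -> end_deriv r (tau 0%N) = p0 D r;
  final_con : forall r, (r <= nf D)%N -> end_deriv r (tau v) = pf D r }.

End FlatSOCP.

(* Main.v *)
(* On each knot interval the B-spline basis functions are polynomials obeying
   the classical derivative formula, an algebraic consequence of the Cox-de
   Boor recursion. Interior knots being simple, adjacent pieces of degree at
   least 2 agree to first order, so the formula survives at the knots and the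
   first three derivatives of the curve are splines whose control points are
   the columns of P B_r. Local support, nonnegativity and partition of unity
   make each derivative at t a convex combination of its active control points;
   hence every second-order cone constraint passes from the control points to
   the curve. With zero yaw the angle bounds reduce to the cone
   cot(eps) |(T_x, T_y)| <= T_z, and the body rates are bounded by
   |r'''| / |T| <= wmax zeta / zeta. *)
Require Import Defs.
From mathcomp Require Import all_boot all_order all_algebra.
From mathcomp Require Import all_classical all_reals all_analysis.
From mathcomp Require Import zify ring lra.
Import Order.TTheory GRing.Theory Num.Theory.
Import numFieldNormedType.Exports.
Local Open Scope classical_set_scope.
Local Open Scope ring_scope.

Set Implicit Arguments.
Unset Strict Implicit.
Unset Printing Implicit Defensive.

(** * Polynomial pieces of B-splines *)

Section Pieces.
Context {R : realType}.
Implicit Types (tau e : nat -> R) (t : R).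

(* The recursion of [cox_de_boor] started from arbitrary degree-0 values [e];
   for [e] the indicator of [l] it is the polynomial that [cox_de_boor] equals
   on [tau l, tau l.+1[. *)
Fixpoint cdb tau e (i k : nat) t : R :=
  match k with
  | 0 => e i
  | k'.+1 =>
      (t - tau i) / (tau (i + k)%N - tau i) * cdb tau e i k' t
      + (tau (i + k).+1 - t) / (tau (i + k).+1 - tau i.+1)
        * cdb tau e i.+1 k' t
  end.

Lemma cox_de_boorE tau i k t :
  cox_de_boor tau i k t
  = cdb tau (fun j => if tau j <= t < tau j.+1 then 1 else 0) i k t.
Proof. by elim: k i => [//|k IH] i /=; rewrite !IH. Qed.

Lemma eq_cdb tau e e' i k t :
  (forall j, (i <= j <= i + k)%N -> e j = e' j) ->
  cdb tau e i k t = cdb tau e' i k t.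
Proof.
elim: k i => [|k IH] i ee' /=; first by apply: ee'; lia.
by rewrite (IH i) ?(IH i.+1)// => j ij; apply: ee'; lia.
Qed.

Lemma cdb_eq0 tau e i k t :
  (forall j, (i <= j <= i + k)%N -> e j = 0) -> cdb tau e i k t = 0.
Proof.
elim: k i => [|k IH] i e0 /=; first by apply: e0; lia.
by rewrite (IH i) ?(IH i.+1) ?mulr0 ?addr0// => j ij; apply: e0; lia.
Qed.

(** Induction on the degree: the product rule on the recursion, with the induction hypothesis for
    both lower-degree functions, gives the claim up to one coefficient. Monotonicity of the knots
    settles the zero denominators there. *)
Lemma is_derive_cdb tau e n i k t :
  (forall a b, (a <= b <= n)%N -> tau a <= tau b) -> (i + k.+1 < n)%N ->
  is_derive t 1 (cdb tau e i k.+1)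
    (k.+1%:R * (cdb tau e i k t / (tau (i + k.+1)%N - tau i)
              - cdb tau e i.+1 k t / (tau (i + k.+1).+1 - tau i.+1))).
Proof.
move=> mono; elim: k i => [|k IH] i ikn.
  rewrite [X in is_derive _ _ X _](_ : _ = (fun s =>
     (s - tau i) / (tau (i + 1)%N - tau i) * e i
    + (tau (i + 1).+1 - s) / (tau (i + 1).+1 - tau i.+1) * e i.+1)) //=.
  set a := (_ - tau i)^-1; set b := (_ - tau i.+1)^-1.
  apply: is_derive_eq.
  rewrite !scaler0 ?addr0 ?add0r /GRing.scale/=; ring.
have D1 := IH i ltac:(lia).
have D2 := IH i.+1 ltac:(lia).
rewrite [X in is_derive _ _ X _](_ : _ = (fun s =>
   (s - tau i) / (tau (i + k.+2)%N - tau i) * cdb tau e i k.+1 s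
  + (tau (i + k.+2).+1 - s) / (tau (i + k.+2).+1 - tau i.+1)
    * cdb tau e i.+1 k.+1 s)); last by apply/funext => s; rewrite /= !addnS.
apply: is_derive_eq; rewrite /= !addSn !addnS /GRing.scale/=.
(* The two sides differ only in the coefficient of [cdb tau e i.+1 k t]. *)
set x0 := cdb _ _ i k t; set x1 := cdb _ _ i.+1 k t; set x2 := cdb _ _ i.+2 k t.
set a := (_ - tau i)^-1; set b := (_ - tau i)^-1; set c := (_ - tau i.+1)^-1.
set f := (_ - tau i.+1)^-1; set h := (_ - tau i.+2)^-1.
suff E : x1 * c * ((tau (i + k).+3 - tau i.+1) * f
                   - (tau (i + k).+2 - tau i) * a) = 0.
  apply/subr0_eq/(etrans _ (etrans (congr1 ( *%R k.+1%:R) E) (mulr0 _))).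
  rewrite -[k.+2%:R]natr1; ring.
(* If the span from [tau i.+1] to [tau (i + k).+2] is empty, [c] is 0; otherwise both longer spans
   contain it, and both products in the bracket equal 1. *)
have := mono i.+1 (i + k).+2 ltac:(lia).
rewrite le_eqVlt => /predU1P[E|lt12].
  by rewrite /c E subrr invr0 mulr0 mul0r.
have le01 := mono i i.+1 ltac:(lia).
have le23 := mono (i + k).+2 (i + k).+3 ltac:(lia).
rewrite !divff ?subrr ?mulr0// subr_eq0; apply/eqP; lra.
Qed.

(** A weight of the recursion can be negative only where the function it multiplies vanishes: if [l]
    lies in the index range of that function, monotone knots put [t] on the right side of the knot
    in the weight. *)
Lemma cdb_ge0 tau n l i k t :
  (forall a b, (a <= b <= n)%N -> tau a <= tau b) -> (i + k < n)%N ->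
  (l < n)%N -> tau l <= t <= tau l.+1 ->
  0 <= cdb tau (fun j => (j == l)%:R) i k t.
Proof.
move=> mono + ln tl; elim: k i => [|k IH] i ikn; first by rewrite ler0n.
have H i' : (i' + k < n)%N -> (i' <= l <= i' + k)%N \/
    cdb tau (fun j => (j == l)%:R) i' k t = 0.
  move=> i'n; have [?|il] := boolP (i' <= l <= i' + k)%N; [by left|right].
  by apply: cdb_eq0 => j ij; case: eqP => // jl; lia.
have le0 x y : x <= y -> (0 <= y - x) * (0 <= (y - x)^-1).
  by rewrite invr_ge0 subr_ge0 => ->.
rewrite /=; apply: addr_ge0.
  have [il|->] := H i ltac:(lia); last by rewrite mulr0.
  rewrite !mulr_ge0 ?IH ?le0 ?mono//; [|lia..].
  by have := mono i l ltac:(lia); lra.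
have [il|->] := H i.+1 ltac:(lia); last by rewrite mulr0.
rewrite !mulr_ge0 ?IH ?le0 ?mono//; [|lia..].
by have := mono l.+1 (i + k.+1).+1 ltac:(lia); lra.
Qed.

(** Lowering the degree by one preserves the sum: after shifting the second half of the recursion by
    one index, the two weights of each lower-degree function add up to 1. *)
Lemma sum_cdb tau e d N k t :
  (forall i, (i <= d)%N -> tau i = tau 0%N) ->
  (forall i, (N < i <= N + d + 1)%N -> tau i = tau N.+1) ->
  (forall i j, (i < j <= N + d + 1)%N -> (i <= N)%N -> (d < j)%N ->
    tau i != tau j) ->
  (k <= d <= N)%N ->
  \sum_(d - k <= i < N.+1) cdb tau e i k t = \sum_(d <= i < N.+1) e i.
Proof.
move=> tl tr tne; elim: k => [|k IH] kd; first by rewrite subn0.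
rewrite -IH; last by lia.
have -> : (d - k = (d - k.+1).+1)%N by lia.
set r := (d - k.+1)%N.
rewrite /= big_split/= (@big_cat_nat _ _ _ r.+1)//=; [|lia..].
rewrite big_nat1 -(big_add1 _ _ r N.+2 xpredT (fun i =>
  (tau (i + k.+1)%N - t) / (tau (i + k.+1)%N - tau i) * cdb tau e i k t)).
rewrite [X in _ + X](@big_cat_nat _ _ _ N.+1)//=; [|lia..].
(* The two unpaired boundary terms have denominators between coinciding clamped knots, hence are
   0. *)
rewrite big_nat1 tl; last by lia.
rewrite (tr (N.+1 + k.+1)%N)//; last by lia.
rewrite [tau (r + _)%N]tl; last by lia.
rewrite !subrr !invr0 !(mulr0, mul0r) add0r addr0 -big_split/=.
rewrite big_nat_cond [RHS]big_nat_cond; apply: eq_bigr => i /andP[iN _].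
rewrite -mulrDl -mulrDl.
rewrite [X in X / _](_ : _ = tau (i + k.+1)%N - tau i); last by ring.
by rewrite divff ?mul1r// subr_eq0 eq_sym tne//; lia.
Qed.

(** The induction starts at degree 1, where hat functions are continuous at a simple knot although
    the indicators jump; the recursion weights do not depend on the piece, so agreement propagates
    upwards. *)
Lemma cdb_glue tau l i k :
  tau l < tau l.+1 -> tau l.+1 < tau l.+2 ->
  cdb tau (fun j => (j == l)%:R) i k.+1 (tau l.+1)
  = cdb tau (fun j => (j == l.+1)%:R) i k.+1 (tau l.+1).
Proof.
move=> lt01 lt12; elim: k i => [|k IH] i; last first.
  by rewrite /= -!/(cdb _ _ _ k.+1 _) !IH.
rewrite /= addn1 eqSS.
have E1 : (l.+1 == l) = false by lia.
have E2 : (l.+2 == l) = false by lia.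
have [->|il] := eqVneq i l.+1.
  by rewrite subrr !mul0r E1 E2 /= mulr0.
have [->|il'] := eqVneq i l.
  by rewrite E1 /= !mulr1 !mulr0 addr0 add0r !divff ?subr_eq0 ?gt_eqF.
have [<-|il''] := eqVneq i.+1 l; first by rewrite subrr !mul0r mulr0.
by rewrite !mulr0.
Qed.

End Pieces.

(** * Derivatives relative to an interval *)

Section DerivOn.
Context {R : realType}.
Implicit Types (V : normedModType R) (t : R).

Lemma is_derive_cvg V (f : R -> V) t (df : V) : is_derive t 1 f df ->
  (s - t)^-1 *: (f s - f t) @[s --> t^'] --> df.
Proof.
case=> fd <-; move/cvg_ex : (fd) => [l fl].
have <- : l = 'D_1 f t by rewrite /derive; apply/esym/norm_cvg_lim.
have tt : (s - t) @[s --> t] --> (0 : R).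
  by rewrite -(subrr t); apply: cvgB; [exact: cvg_id|exact: cvg_cst].
move=> U /fl fU; have := tt _ fU; rewrite !near_simpl.
apply: filterS => s /= + /eqP st; rewrite subr_eq0.
by move=> /(_ (introN eqP st)); rewrite /GRing.scale/= mulr1 subrK.
Qed.

(** Points just to the right of [t] lie in the interval, even for [t = a]; properness is what makes
    the limit in [deriv_on] unique. *)
Lemma proper_within_co (a b t : R) : a <= t < b ->
  ProperFilter (within [set s | a <= s < b] t^').
Proof.
move=> /andP[lea ltb]; apply: Build_ProperFilter_ex => U.
rewrite /within /dnbhs /within /= => tU.
have := @filter_ex _ t^'+ _ _ (filterI (filterI
  (@cvg_within _ (nbhs t) _ (fun u => t < u) _ tU) (nbhs_right_lt ltb))
  (nbhs_right_gt t)).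
case=> s [[/= sU sb] ts]; exists s.
by apply: sU; [rewrite gt_eqF|rewrite sb (le_trans lea)// ltW].
Qed.

Lemma deriv_on_unique V (a b t : R) (f : R -> V) (l : V) :
  a <= t < b ->
  (s - t)^-1 *: (f s - f t) @[s --> within [set s | a <= s < b] t^'] --> l ->
  deriv_on [set s | a <= s < b] f t = l.
Proof.
by move=> tab fl; have ? := proper_within_co tab; apply: norm_cvg_lim.
Qed.

Lemma eq_deriv_on V (J : set R) (f g : R -> V) t :
  {in J, f =1 g} -> J t -> deriv_on J f t = deriv_on J g t.
Proof.
move=> fg Jt; have e s : J s -> f s = g s by move=> ?; apply/fg/mem_set.
rewrite /deriv_on; congr (lim _); apply/seteqP.
by split=> U H; apply: (@filterS _ t^' _ _ _ _ H) => s Us Js;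
  have := Us Js; rewrite /= !e.
Qed.

(** Both difference quotients tend to [l], and that of [h] equals one of them at every nearby point,
    so one-sided limits need not be treated separately. *)
Lemma cvg_within_glue (J : set R) (f g h : R -> R) (t l : R) :
  is_derive t 1 f l -> is_derive t 1 g l ->
  (\forall s \near t, J s -> h s - h t = f s - f t \/ h s - h t = g s - g t) ->
  (s - t)^-1 *: (h s - h t) @[s --> within J t^'] --> l.
Proof.
move=> /is_derive_cvg fl /is_derive_cvg gl hfg U lU.
have := gl _ lU; have := fl _ lU; rewrite /= /within /= /dnbhs /within /=.
near_simpl; apply: filterS3 hfg => s hfg fU gU st Js.
by case: (hfg Js) => ->; [apply: fU|apply: gU].
Qed.

Lemma cvg_sumr (I : Type) (r : seq I) (p : pred I) V (T : Type)
    (F : set_system T) {FF : Filter F} (f : I -> T -> V) (l : I -> V) :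
  (forall i, p i -> f i x @[x --> F] --> l i) ->
  \sum_(i <- r | p i) f i x @[x --> F] --> \sum_(i <- r | p i) l i.
Proof. by move=> fl; apply: cvg_big => //; apply: add_continuous. Qed.

End DerivOn.

(** * Clamped uniform knots *)

Section Clamped.
Context {R : realType}.
Variables (d N : nat) (tau : nat -> R).
Hypothesis htau : clamped_uniform d N tau.
Local Notation J := [set t | tau 0%N <= t < tau (last_knot d N)].

Lemma knots_mono a b : (a <= b <= N + d + 1)%N -> tau a <= tau b.
Proof.
elim: b => [|b IH] ab; first by have -> : a = 0%N by lia.
have [->//|ab'] := eqVneq a b.+1.
apply: le_trans (IH ltac:(lia)) _.
by apply: (knots_le htau); rewrite /last_knot; lia.
Qed.

Lemma knots_left i : (i <= d)%N -> tau i = tau 0%N.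
Proof. exact: (knots_clamped_left htau). Qed.

Lemma knots_last : tau (last_knot d N) = tau N.+1.
Proof.
by rewrite -(knots_clamped_right htau (i := N.+1))// /last_knot; lia.
Qed.

Lemma knots_right i : (N < i <= N + d + 1)%N -> tau i = tau N.+1.
Proof.
by move=> iN; rewrite (knots_clamped_right htau) ?knots_last// /last_knot; lia.
Qed.

Lemma knots_step i : (d <= i <= N)%N -> tau i < tau i.+1.
Proof.
move=> iN; rewrite -subr_gt0 (knots_uniform htau iN) lt_neqAle.
rewrite subr_ge0 knots_mono ?andbT; last by lia.
(* A zero common step would collapse all knots from [tau d] to [tau N.+1], contradicting
   [tau 0 < tau (last_knot d N)]. *)
apply/negP => /eqP h0; have := knots_lt htau.
rewrite knots_last -(knots_left (leqnn d)).
suff H j : (d + j <= N.+1)%N -> tau (d + j)%N = tau d.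
  have := H (N.+1 - d)%N ltac:(lia); rewrite subnKC; last by lia.
  by move->; rewrite ltxx.
elim: j => [|j IH] jN; first by rewrite addn0.
rewrite addnS -IH; last by lia.
by apply/eqP; rewrite -subr_eq0 (knots_uniform htau) -?h0//; lia.
Qed.

Lemma cox_de_boor_piece l i k t : (l <= N + d)%N -> tau l <= t < tau l.+1 ->
  (i + k <= N + d)%N ->
  cox_de_boor tau i k t = cdb tau (fun j => (j == l)%:R) i k t.
Proof.
move=> lN /andP[tl tl1] ik; rewrite cox_de_boorE; apply: eq_cdb => j jk.
have [->|] := eqVneq j l; first by rewrite tl tl1.
rewrite neq_ltn => /orP[jl|lj].
  suff -> : (t < tau j.+1) = false by rewrite andbF.
  by apply/negbTE; rewrite -leNgt; apply: le_trans (knots_mono _) tl; lia.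
suff -> : (tau j <= t) = false by [].
by apply/negbTE; rewrite -ltNge; apply: lt_le_trans tl1 (knots_mono _); lia.
Qed.

Lemma cox_de_boor_supp l i k t : (l <= N + d)%N -> tau l <= t < tau l.+1 ->
  (i + k <= N + d)%N -> cox_de_boor tau i k t != 0 -> (i <= l <= i + k)%N.
Proof.
move=> lN tl ik; rewrite (cox_de_boor_piece (l := l))//.
apply: contra_neqT => il; apply: cdb_eq0 => j jk.
by case: eqP => // jl; lia.
Qed.

Hypothesis dN : (d <= N)%N.

Lemma knots_lt_across i j : (i < j <= N + d + 1)%N -> (i <= N)%N -> (d < j)%N ->
  tau i < tau j.
Proof.
move=> ij iN dj; have [id|id] := leqP d i.
  apply: lt_le_trans (knots_step (i := i) ltac:(lia)) _.
  by apply: knots_mono; lia.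
rewrite knots_left ?(ltnW id)// -(knots_left (leqnn d)).
apply: lt_le_trans (knots_step (i := d) ltac:(lia)) _.
by apply: knots_mono; lia.
Qed.

(** The index is the largest [i <= N] with [tau i <= t]; it is at least [d] because [tau d] equals
    [tau 0]. *)
Lemma knots_locate t : J t ->
  exists2 l, (d <= l <= N)%N & tau l <= t < tau l.+1.
Proof.
rewrite /= knots_last => /andP[t0 tN].
have exP : exists i, (i <= N)%N && (tau i <= t) by exists 0%N; rewrite t0.
have ubP i : (i <= N)%N && (tau i <= t) -> (i <= N)%N by case/andP.
case: (ex_maxnP exP ubP) => l /andP[lN lt] lmax; exists l.
  rewrite lN andbT; apply: lmax; rewrite dN knots_left//.
rewrite lt ltNge /=; apply/negP => lt'.
have := lmax l.+1; rewrite lt' andbT.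
have [lN'|lN'] := eqVneq l N; first by move: lt'; rewrite lN' leNgt tN.
by rewrite (_ : (l < N)%N); [move=> /(_ isT); rewrite ltnn|lia].
Qed.

Lemma cox_de_boor_ge0 i k t : (i + k <= N + d)%N -> J t ->
  0 <= cox_de_boor tau i k t.
Proof.
move=> ik /knots_locate[l lN tl].
rewrite (cox_de_boor_piece (l := l))//; [|lia].
apply: (@cdb_ge0 _ _ (N + d + 1)); [exact: knots_mono|lia|lia|].
by case/andP: tl => -> /ltW ->.
Qed.

Lemma sum_cox_de_boor k t : (k <= d)%N -> J t ->
  \sum_(d - k <= i < N.+1) cox_de_boor tau i k t = 1.
Proof.
move=> kd /knots_locate[l lN tl].
transitivity (\sum_(d - k <= i < N.+1) cdb tau (fun j => (j == l)%:R) i k t).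
  rewrite big_nat [RHS]big_nat; apply: eq_bigr => i iN.
  by apply: cox_de_boor_piece => //; lia.
rewrite sum_cdb; [|exact: knots_left|exact: knots_right| |lia]; last first.
  by move=> i j ij iN dj; rewrite lt_eqF// knots_lt_across.
rewrite (bigD1_seq l) ?mem_index_iota ?iota_uniq//=.
rewrite eqxx big1 ?addr0// => i /negbTE -> //.
Qed.

Lemma cvg_cox_de_boor i k t : (i + k.+2 <= N + d)%N -> J t ->
  (s - t)^-1 *: (cox_de_boor tau i k.+2 s - cox_de_boor tau i k.+2 t)
    @[s --> within J t^'] -->
  k.+2%:R * (cox_de_boor tau i k.+1 t / (tau (i + k.+2)%N - tau i)
           - cox_de_boor tau i.+1 k.+1 t / (tau (i + k.+2).+1 - tau i.+1)).
Proof.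
move=> ik Jt; have [l lN /andP[lt tl]] := knots_locate Jt.
pose piece m := cdb tau (fun j => (j == m)%:R).
pose p m := piece m i k.+2.
pose q m := k.+2%:R * (piece m i k.+1 t / (tau (i + k.+2)%N - tau i)
  - piece m i.+1 k.+1 t / (tau (i + k.+2).+1 - tau i.+1)).
have pq m : is_derive t 1 (p m) (q m).
  by apply: (@is_derive_cdb _ _ _ (N + d + 1)); [exact: knots_mono|lia].
have E m s : (d <= m <= N)%N -> tau m <= s < tau m.+1 ->
    cox_de_boor tau i k.+2 s = p m s.
  by move=> mN ms; apply: cox_de_boor_piece => //; lia.
set df := (X in _ --> X); have -> : df = q l.
  by rewrite /df !(cox_de_boor_piece (l := l)) ?lt ?tl//; lia.
have Et := E l t lN ltac:(by rewrite lt tl).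
(* Strictly inside a knot span, a single polynomial describes the function near [t]. *)
have [tl'|tl'] := ltP (tau l) t.
  apply: (cvg_within_glue (f := p l) (g := p l)) => //.

  near=> s => Js; left; rewrite Et (E l)//; apply/andP; split.
    by apply: ltW; near: s; exact: lt_nbhsr.
  by near: s; exact: lt_nbhsl.
have {}tl' : t = tau l by lra.
(* At the left end [t = tau d], only points to the right belong to [J], so one piece again
   suffices. *)
have [ld|dl] := leqP l d.
  have {}ld : l = d by lia.
  apply: (cvg_within_glue (f := p l) (g := p l)) => //.
  near=> s => Js; left; rewrite Et (E l)//.
  case/andP: Js; rewrite -(knots_left (leqnn d)) ld => -> _ /=.
  by near: s; rewrite -ld; exact: lt_nbhsl.
(* At an interior knot, piece [l] lies to the left and piece [l.+1] to the right. [cdb_glue] matches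
   their values and also their derivatives, which still have degree at least 1. *)
case: l => [//|l] in lN lt tl Et tl' dl *.
have lt01 : tau l < tau l.+1 by apply: knots_step; lia.
have lt12 : tau l.+1 < tau l.+2 by apply: knots_step; lia.
have qq : q l = q l.+1 by rewrite /q /piece tl' !cdb_glue.
have pp : p l t = p l.+1 t by rewrite /p /piece tl' !cdb_glue.
apply: (cvg_within_glue (f := p l) (g := p l.+1)) => //; first by rewrite -qq.
have lt0t : tau l < t by rewrite tl'.
apply: filterS2 (lt_nbhsr lt0t) (lt_nbhsl tl) => s ls sl Js.
have [st|ts] := ltP s t; [left|right].
  by rewrite Et -pp (E l)//; [lia|rewrite -tl' st ltW].
by rewrite Et (E l.+1)// -tl' ts.
Unshelve. all: by end_near.
Qed.

End Clamped.

(** * Derivatives of spline curves *)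

Section Spline.
Context {R : realType}.
Variables (d N : nat) (tau : nat -> R).

(* Control points of the [r]-th derivative, indexed so that [dctrl Q r j] goes
   with [cox_de_boor tau j (d - r)]; meaningful for [r <= j] only. *)
Fixpoint dctrl (V : lmodType R) (Q : nat -> V) (r j : nat) : V :=
  match r with
  | 0 => Q j
  | r'.+1 => ((d - r')%:R / (tau (j + (d - r'))%N - tau j))
             *: (dctrl Q r' j - dctrl Q r' j.-1)
  end.

(** The range from [r] to [N] is the block of columns that [Cmx r] does not annihilate. *)
Definition spline (V : lmodType R) (Q : nat -> V) (r : nat) (t : R) : V :=
  \sum_(r <= j < N.+1) cox_de_boor tau j (d - r) t *: dctrl Q r j.

(** Each column of [Fmx] has just two nonzero entries, opposite to each other, so multiplying by it
    forms scaled differences of neighbouring control points. *)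
Lemma sum_Mmx (P : 'M[R]_(3, N.+1)) r (k : 'I_(N.+1 - r)) : (r <= d)%N ->
  \sum_i Mmx d N tau r i k *: col i P
  = dctrl (fun j => col (inord j) P) r (r + k).
Proof.
elim: r k => [|r IH] k rd.
  rewrite (bigD1 (inord k))//= mxE.
  have kN : (k < N.+1)%N := ltn_ord k.
  rewrite (_ : (_ == k) = true); last by apply/eqP/val_inj; rewrite /= inordK.
  rewrite scale1r big1 ?addr0// => i ik; rewrite mxE.
  case: eqP => [E|_]; last by rewrite scale0r.
  by case/eqP: ik; apply: val_inj; rewrite /= inordK// E.
have kN : (k.+1 < N.+1 - r)%N by have := ltn_ord k; lia.
pose k0 : 'I_(N.+1 - r) := Ordinal (ltnW kN).
pose k1 : 'I_(N.+1 - r) := Ordinal kN.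
transitivity (\sum_(l < N.+1 - r) Fmx d N tau r.+1 l k *:
    dctrl (fun j => col (inord j) P) r (r + l)).
  under [RHS]eq_bigr => l _ do rewrite -IH ?(ltnW rd)// scaler_sumr.
  rewrite exchange_big; apply: eq_bigr => i _ /=; rewrite mxE scaler_suml.
  by apply: eq_bigr => l _; rewrite scalerA mulrC.
rewrite (bigD1 k0)//= (bigD1 k1)/=; last by rewrite -val_eqE /= gtn_eqF.
rewrite big1 ?addr0; last first.
  move=> l /andP[l0 l1]; rewrite mxE (negbTE (_ : (l != k :> nat)))//.
  by rewrite (negbTE (_ : (l != k.+1 :> nat)))// scale0r.
rewrite !mxE /= eqxx gtn_eqF// eqxx addnS addSn /= scaleNr addrC -scalerBr.
congr (_ *: _); rewrite /aco; congr (_%:R / (tau _ - tau _)); lia.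
Qed.

Lemma ctrlE (P : 'M[R]_(3, N.+1)) r (j : 'I_(N.+1 + r)) : (r <= d)%N ->
  (r <= j <= N)%N ->
  ctrl d tau P j = dctrl (fun j => col (inord j) P) r j.
Proof.
move=> rd /andP[rj jN].
have kN : (j - r < N.+1 - r)%N by lia.
rewrite /ctrl -(subnKC rj) -(@sum_Mmx P r (Ordinal kN))//.
apply: eq_bigr => i _; congr (_ *: _); rewrite /Bmx mxE (bigD1 (Ordinal kN))//=.
rewrite mxE /= subnKC// eqxx mulr1 big1 ?addr0// => l lj; rewrite mxE.
case: eqP => [E|]; last by rewrite mulr0.
by case/eqP: lj; apply: val_inj; rewrite /= E; lia.
Qed.

Hypotheses (htau : clamped_uniform d N tau) (dN : (d <= N)%N).
Local Notation J := [set t | tau 0%N <= t < tau (last_knot d N)].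

Lemma bspline_curveE (P : 'M[R]_(3, N.+1)) t : J t ->
  bspline_curve d tau P t = spline (fun j => col (inord j) P) 0 t.
Proof.
move=> /andP[_ tv]; rewrite /bspline_curve /spline subn0 big_mkord.
have -> : P *m Bmx d N tau 0 = P *m Cmx R N 0 by rewrite /Bmx /= mul1mx.
apply/matrixP => a b; rewrite ord1 summxE -mulmxA mxE; apply: eq_bigr => i _.
rewrite !mxE (bigD1 (cast_ord (esym (addn0 N.+1)) i))//=.
rewrite !mxE /= add0n eqxx mul1r.
rewrite big1 ?addr0; last first.
  move=> j ji; rewrite !mxE add0n; case: eqP => [E|]; last by rewrite mul0r.
  by case/eqP: ji; apply: val_inj.
(* As [t] lies before the last knot, [lambda] is not in its left-limit case. *)
by rewrite /lambda lt_eqF// subn0 mulrC inord_val.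
Qed.

Lemma deriv_on_spline (V : normedModType R) (Q : nat -> V) r t :
  (r.+2 <= d)%N -> J t ->
  deriv_on J (spline Q r) t = spline Q r.+1 t.
Proof.
move=> rd Jt; apply: deriv_on_unique => //.
have [k kE] : exists k, d = (r + k.+2)%N by exists (d - r.+2)%N; lia.
pose m j := cox_de_boor tau j k.+1 t / (tau (j + k.+2)%N - tau j).
have -> : spline Q r.+1 t =
    \sum_(r <= j < N.+1) (k.+2%:R * (m j - m j.+1)) *: dctrl Q r j.
  (* Summation by parts moves the difference from the basis functions to the control points; the end
     terms [m r] and [m N.+1] vanish because the knots are clamped. *)
  under [RHS]eq_bigr => j _ do rewrite mulrBr scalerBl.
  rewrite sumrB big_nat_recl/=; last by lia.
  rewrite [X in _ - X]big_nat_recr/=; last by lia.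
  have -> : m r = 0.
    rewrite /m (knots_left htau) ?(knots_left htau (i := r)); [|lia..].
    by rewrite subrr invr0 mulr0.
  have -> : m N.+1 = 0.
    by rewrite /m (knots_right htau) ?subrr ?invr0 ?mulr0//; lia.
  rewrite !mulr0 !scale0r add0r addr0 -sumrB /spline big_add1.
  apply: eq_bigr => j _ /=; rewrite /m -scalerBr scalerA.
  have [-> ->] : (d - r = k.+2 /\ d - r.+1 = k.+1)%N by lia.
  by rewrite mulrCA.
rewrite [X in _ --> X]big_nat (_ : (fun s => _) = (fun s =>
   \sum_(r <= j < N.+1 | (r <= j < N.+1)%N) ((s - t)^-1 *:
   (cox_de_boor tau j k.+2 s - cox_de_boor tau j k.+2 t)) *: dctrl Q r j)).
  apply: cvg_sumr => j jN; apply: cvgZr_tmp.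
  by apply: cvg_cox_de_boor => //; lia.
apply/funext => s; rewrite -big_nat /spline -sumrB scaler_sumr.
by apply: eq_bigr => j _; rewrite kE addKn -scalerBl scalerA.
Qed.

End Spline.

(** * Second-order cones *)

Section EuclideanNorm.
Context {R : realType}.
Implicit Types (a : R) (n : nat).

Lemma norm2_ge0 n (u : 'cV[R]_n) : 0 <= norm2 u.
Proof. exact: sqrtr_ge0. Qed.

Lemma norm2_sqr n (u : 'cV[R]_n) : norm2 u ^+ 2 = dotp u u.
Proof.
rewrite sqr_sqrtr; first by apply: eq_bigr => i _; rewrite expr2.
by apply: sumr_ge0 => i _; apply: sqr_ge0.
Qed.

Lemma dotpC n (u w : 'cV[R]_n) : dotp u w = dotp w u.
Proof. by apply: eq_bigr => i _; rewrite mulrC. Qed.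

Lemma dotpDr n (u w x : 'cV[R]_n) : dotp u (w + x) = dotp u w + dotp u x.
Proof. by rewrite -big_split; apply: eq_bigr => i _; rewrite mxE mulrDr. Qed.

Lemma dotpZr n a (u w : 'cV[R]_n) : dotp u (a *: w) = a * dotp u w.
Proof. by rewrite mulr_sumr; apply: eq_bigr => i _; rewrite mxE mulrCA. Qed.

Lemma dotpDl n (u w x : 'cV[R]_n) : dotp (w + x) u = dotp w u + dotp x u.
Proof. by rewrite dotpC dotpDr !(dotpC u). Qed.

Lemma dotpZl n a (u w : 'cV[R]_n) : dotp (a *: u) w = a * dotp u w.
Proof. by rewrite dotpC dotpZr dotpC. Qed.

Lemma dotp0r n (u : 'cV[R]_n) : dotp u 0 = 0.
Proof. by rewrite -(scale0r 0) dotpZr mul0r. Qed.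

Lemma dotp_sumr n (I : Type) (r : seq I) (F : I -> 'cV[R]_n) (u : 'cV[R]_n) :
  dotp u (\sum_(i <- r) F i) = \sum_(i <- r) dotp u (F i).
Proof.
by elim/big_rec2: _ => [|i y x _ <-]; [rewrite dotp0r|rewrite dotpDr].
Qed.

Lemma dotp_ge0 n (u : 'cV[R]_n) : 0 <= dotp u u.
Proof. by rewrite -norm2_sqr sqr_ge0. Qed.

Lemma norm2_eq0 n (u : 'cV[R]_n) : norm2 u = 0 -> u = 0.
Proof.
move=> u0; have /eqP := norm2_sqr u; rewrite u0 expr0n eq_sym psumr_eq0.
  by move=> /allP u00; apply/matrixP => i j; rewrite ord1 mxE; apply/eqP;
    have := u00 i (mem_index_enum i); rewrite /= mulf_eq0 orbb.
by move=> i _; rewrite -expr2 sqr_ge0.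
Qed.

Lemma dotp_le n (u w : 'cV[R]_n) : `|dotp u w| <= norm2 u * norm2 w.
Proof.
rewrite -[leRHS]ger0_norm ?mulr_ge0 ?norm2_ge0// -ler_sqr ?nnegrE//.
rewrite !real_normK ?num_real// exprMn.
have [/norm2_eq0 -> |w0] := eqVneq (norm2 w) 0.
  by rewrite dotp0r expr0n mulr_ge0 ?sqr_ge0.
have w2 : 0 < norm2 w ^+ 2 by rewrite exprn_gt0// lt_neqAle eq_sym w0 norm2_ge0.
(* Cauchy-Schwarz: this vector is a multiple of the component of [u] orthogonal to [w], and its
   squared norm carries a factor [norm2 w ^+ 2] that is divided out. *)
have := dotp_ge0 (norm2 w ^+ 2 *: u + (- dotp u w) *: w).
rewrite !(dotpDr, dotpDl, dotpZr, dotpZl) (dotpC w u) -!norm2_sqr => H.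
rewrite -subr_ge0 -(pmulr_rge0 _ w2); lra.
Qed.

Lemma norm2D n (u w : 'cV[R]_n) : norm2 (u + w) <= norm2 u + norm2 w.
Proof.
rewrite -ler_sqr ?nnegrE ?addr_ge0 ?norm2_ge0// norm2_sqr.
rewrite !(dotpDr, dotpDl) (dotpC w u) -!norm2_sqr.
have := le_trans (ler_norm _) (dotp_le u w); lra.
Qed.

Lemma norm2Z n a (u : 'cV[R]_n) : norm2 (a *: u) = `|a| * norm2 u.
Proof.
rewrite /norm2 -sqrtr_sqr -sqrtrM ?sqr_ge0// mulr_sumr.
by congr Num.sqrt; apply: eq_bigr => i _; rewrite mxE exprMn.
Qed.

Lemma norm20 n : norm2 (0 : 'cV[R]_n) = 0.
Proof. by rewrite -(scale0r 0) norm2Z normr0 mul0r. Qed.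

Lemma norm2_sum n (I : Type) (r : seq I) (F : I -> 'cV[R]_n) :
  norm2 (\sum_(i <- r) F i) <= \sum_(i <- r) norm2 (F i).
Proof.
elim/big_rec2: _ => [|i y x _ H]; first by rewrite norm20.
by apply: le_trans (norm2D _ _) _; rewrite lerD2l.
Qed.

Definition soc m n (A : 'M[R]_(m, n)) (b : 'cV[R]_m) (c : 'cV[R]_n) (e : R) :
  set 'cV[R]_n := [set p | norm2 (A *m p + b) <= dotp c p + e].

(** Weights summing to 1 commute with both affine maps, and the triangle inequality does the rest.
    Membership is asked only where the weight is nonzero, so that local support can be exploited. *)
Lemma soc_convex m n (A : 'M[R]_(m, n)) b c e (I : eqType) (s : seq I)
    (w : I -> R) (x : I -> 'cV[R]_n) :
  {in s, forall i, 0 <= w i} -> \sum_(i <- s) w i = 1 ->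
  {in s, forall i, w i != 0 -> soc A b c e (x i)} ->
  soc A b c e (\sum_(i <- s) w i *: x i).
Proof.
move=> w0 w1 xA; rewrite /soc /=.
have -> : A *m (\sum_(i <- s) w i *: x i) + b
    = \sum_(i <- s) w i *: (A *m x i + b).
  rewrite -[in LHS](scale1r b) -w1 scaler_suml mulmx_sumr -big_split.
  by apply: eq_bigr => i _; rewrite scalerDr scalemxAr.
have -> : dotp c (\sum_(i <- s) w i *: x i) + e
    = \sum_(i <- s) w i * (dotp c (x i) + e).
  rewrite -[in LHS](mul1r e) -w1 mulr_suml dotp_sumr -big_split.
  by apply: eq_bigr => i _; rewrite dotpZr mulrDr.
apply: le_trans (norm2_sum _ _) _; rewrite big_seq [leRHS]big_seq.
apply: ler_sum => i si; rewrite norm2Z ger0_norm ?w0//.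
have [->|wi] := eqVneq (w i) 0; first by rewrite !mul0r.
by rewrite ler_wpM2l ?w0// xA.
Qed.

Lemma spline_soc d N (tau : nat -> R) m n (A : 'M[R]_(m, n)) b c e
    (Q : nat -> 'cV[R]_n) r l t :
  (d <= N)%N -> clamped_uniform d N tau -> (r <= d)%N -> (d <= l <= N)%N ->
  tau l <= t < tau l.+1 ->
  (forall j, (r <= j <= N)%N -> (l - d + r <= j <= l)%N ->
    soc A b c e (dctrl d tau Q r j)) ->
  soc A b c e (spline d N tau Q r t).
Proof.
move=> dN htau rd lN tl QA.
have Jt : tau 0%N <= t < tau (last_knot d N).
  case/andP: tl => t1 t2; rewrite (knots_last htau); apply/andP; split.
    by apply: le_trans t1; apply: (knots_mono htau); lia.
  by apply: lt_le_trans t2 _; apply: (knots_mono htau); lia.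
rewrite /spline; apply: soc_convex => [j||j]; rewrite ?mem_index_iota.
- by move=> jN; apply: (cox_de_boor_ge0 htau dN) => //; lia.
- rewrite -[RHS](sum_cox_de_boor htau dN (k := (d - r)%N) _ Jt); last by lia.
  by rewrite subKn.
move=> jN /(cox_de_boor_supp htau _ tl) H; apply: QA; first lia.
have := H ltac:(lia) ltac:(lia); lia.
Qed.

End EuclideanNorm.

(** * The flat map at zero yaw *)

Section FlatMapBounds.
Context {R : realType}.

Lemma sum_ord3 (F : 'I_3 -> R) : \sum_i F i = F 0 + F 1 + F 2%:R.
Proof.
rewrite !big_ord_recl big_ord0 addr0 addrA.
by congr (F _ + F _ + F _); apply: val_inj.
Qed.

Lemma vec3E (a b c : R) :
  (vec3 a b c 0 0 = a) * (vec3 a b c 1 0 = b) * (vec3 a b c 2%:R 0 = c).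
Proof. by rewrite !mxE. Qed.

Lemma dotp_zW (u : 'cV[R]_3) : dotp (zW R) u = u 2%:R 0.
Proof. by rewrite /dotp sum_ord3 !vec3E !mul0r !add0r mul1r. Qed.

Lemma norm2_ord3 (u : 'cV[R]_3) :
  norm2 u = Num.sqrt (u 0 0 ^+ 2 + u 1 0 ^+ 2 + u 2%:R 0 ^+ 2).
Proof. by rewrite /norm2 sum_ord3. Qed.

Lemma norm2_ord3_sqr (u : 'cV[R]_3) :
  norm2 u ^+ 2 = u 0 0 ^+ 2 + u 1 0 ^+ 2 + u 2%:R 0 ^+ 2.
Proof. by rewrite norm2_ord3 sqr_sqrtr// !addr_ge0 ?sqr_ge0. Qed.

Lemma asin_norm_le (x a : R) : 0 < a < pi / 2 -> `|x| <= sin a ->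
  `|asin x| <= a.
Proof.
move=> /andP[a0 api] xa.
have a1 := sin_le1 a.
have x1 : -1 <= x <= 1 by move: xa; rewrite ler_norml => /andP[]; lra.
have in_dom y : -a <= y <= a -> y \in `[(- (pi / 2)), (pi / 2)]%R.
  by rewrite in_itv /= => /andP[? ?]; apply/andP; lra.
have asin_dom : asin x \in `[(- (pi / 2)), (pi / 2)]%R.
  by rewrite in_itv /= asin_geNpi2 ?asin_lepi2.
have sin_mono := @ltr_sin R.
have na : - a \in `[(- (pi / 2)), (pi / 2)]%R by apply: in_dom; lra.
have pa : a \in `[(- (pi / 2)), (pi / 2)]%R by apply: in_dom; lra.
move: xa; rewrite ler_norml -sinN => /andP[xl xr].
have sx : sin (asin x) = x by apply: asinK; rewrite in_itv.
rewrite ler_norml; apply/andP; split; rewrite leNgt; apply/negP.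
  by rewrite -sin_mono// sx ltNge xl.
by rewrite -sin_mono// sx ltNge xr.
Qed.

(* Here [dotp zW y / cos (asin (dotp zW x))] simplifies to [- z 1 0], and
   [dotp zW x] to [- z 0 0 / sqrt (z 0 0 ^+ 2 + z 2 0 ^+ 2)]. *)
Lemma flat_frame (z : 'cV[R]_3) (a : R) :
  norm2 z = 1 -> 0 < z 2%:R 0 -> 0 < a < pi / 2 ->
  cos a ^+ 2 * (z 0 0 ^+ 2 + z 1 0 ^+ 2) <= sin a ^+ 2 * z 2%:R 0 ^+ 2 ->
  let w := crossp (vec3 0 1 0) z in
  let x := (norm2 w)^-1 *: w in
  let y := crossp z x in
  [/\ norm2 x = 1, norm2 y = 1, `|asin (dotp (zW R) x)| <= a
    & `|asin (dotp (zW R) y / cos (asin (dotp (zW R) x)))| <= a].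
Proof.
set z0 := z 0 0; set z1 := z 1 0; set z2 := z 2%:R 0.
move=> nz z2_gt0 ha hcone w x y.
have {}nz : z0 ^+ 2 + z1 ^+ 2 + z2 ^+ 2 = 1.
  by rewrite -norm2_ord3_sqr nz expr1n.
have [a0 api] := andP ha.
have sa : 0 < sin a by apply: sin_gt0_pi; have := pi_gt0 R; lra.
have ca : 0 < cos a by apply: cos_gt0_pihalf; lra.
have cs := cos2Dsin2 a.
pose m := norm2 w.
have w0 : w 0 0 = z2 by rewrite vec3E !vec3E mul1r mul0r subr0.
have w1 : w 1 0 = 0 by rewrite !vec3E !mul0r subrr.
have w2 : w 2%:R 0 = - z0 by rewrite !vec3E mul0r mul1r sub0r.
have m2 : m ^+ 2 = z0 ^+ 2 + z2 ^+ 2.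
  by rewrite norm2_ord3_sqr w0 w1 w2; ring.
have m_gt0 : 0 < m.
  rewrite lt_neqAle norm2_ge0 andbT eq_sym -sqrf_eq0 m2 gt_eqF//.
  by rewrite ltr_wpDl ?sqr_ge0// exprn_gt0.
have x0 : x 0 0 = z2 / m by rewrite mxE w0 mulrC.
have x1 : x 1 0 = 0 by rewrite mxE w1 mulr0.
have x2 : x 2%:R 0 = - z0 / m by rewrite mxE w2 mulrC.
have y0 : y 0 0 = - (z0 * z1) / m.
  by rewrite vec3E x1 x2 -/z1 -/z2; field; exact: lt0r_neq0.
have y1 : y 1 0 = m.
  rewrite vec3E x0 x2 -/z0 -/z2; apply: (mulIf (lt0r_neq0 m_gt0)).
  rewrite -expr2 m2; field; exact: lt0r_neq0.
have y2 : y 2%:R 0 = - (z1 * z2) / m.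
  by rewrite vec3E x0 x1 -/z0 -/z1; field; exact: lt0r_neq0.
have sqr1 (u : 'cV[R]_3) : norm2 u ^+ 2 = 1 -> norm2 u = 1.
  by move=> /eqP; rewrite -{1}(expr1n R 2) eqrXn2 ?norm2_ge0// => /eqP.
have bound (p q : R) : 0 < q -> p ^+ 2 <= (sin a * q) ^+ 2 -> `|p / q| <= sin a.
  move=> q0; rewrite normrM normfV (gtr0_norm q0) ler_pdivrMr// => H.
  have sq0 : 0 <= sin a * q by rewrite ltW ?mulr_gt0.
  by rewrite -ler_sqr ?nnegrE// real_normK ?num_real.
split.
- apply: sqr1; rewrite norm2_ord3_sqr x0 x1 x2.
  rewrite (_ : _ + _ = (z0 ^+ 2 + z2 ^+ 2) / m ^+ 2); last first.
    by field; exact: lt0r_neq0.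
  by rewrite m2 divff// -m2 expf_neq0// lt0r_neq0.
- apply: sqr1; rewrite norm2_ord3_sqr y0 y1 y2.
  rewrite (_ : _ + _ = z1 ^+ 2 * (z0 ^+ 2 + z2 ^+ 2) / m ^+ 2 + m ^+ 2).
    2: by field; exact: lt0r_neq0.
  by rewrite -m2 mulfK ?expf_neq0 ?lt0r_neq0// m2 -nz; ring.
(* Dropping [z1] from the cone inequality and adding [sin a ^+ 2 * z0 ^+ 2] to both sides gives the
   pitch bound. *)
- apply: asin_norm_le => //; rewrite dotp_zW x2; apply: bound => //.
  by rewrite exprMn m2; nra.
rewrite !dotp_zW x2 y2 cos_asin; last first.
  have := sin_le1 a; have : `|- z0 / m| <= sin a.
    by apply: bound => //; rewrite exprMn m2; nra.
  by rewrite ler_norml => /andP[]; lra.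
have -> : 1 - (- z0 / m) ^+ 2 = (z2 / m) ^+ 2.
  rewrite !exprMn sqrrN exprVn m2; field.
  by rewrite -m2 expf_neq0// lt0r_neq0.
rewrite sqrtr_sqr [`|z2 / m|]ger0_norm; last by rewrite divr_ge0// ltW.
rewrite (_ : _ / _ = - z1 / 1); last by field; rewrite !lt0r_neq0.
apply: asin_norm_le => //; apply: bound => //.
(* Since [z] is a unit vector, the cone inequality amounts to [z0 ^+ 2 + z1 ^+ 2 <= sin a ^+ 2]. *)
rewrite mulr1 sqrrN; nra.
Qed.

Lemma perp_le n (z u : 'cV[R]_n) : norm2 z = 1 ->
  norm2 (u - dotp z u *: z) <= norm2 u.
Proof.
move=> z1; rewrite -ler_sqr ?nnegrE ?norm2_ge0// !norm2_sqr.
rewrite -scaleNr !(dotpDr, dotpDl, dotpZr, dotpZl) -(norm2_sqr z) z1.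
rewrite (dotpC u z).
by have := sqr_ge0 (dotp z u); lra.
Qed.

Lemma Aeps_norm (D : flat_data R) (u : 'cV[R]_3) :
  norm2 (Aeps D *m u) = `|cot (eps D)| * Num.sqrt (u 0 0 ^+ 2 + u 1 0 ^+ 2).
Proof.
rewrite /Aeps -scalemxAl norm2Z normr_id norm2_ord3 mul_diag_mx !mxE /=.
by rewrite !mul1r mul0r expr0n addr0.
Qed.

End FlatMapBounds.

(** * From the constraints of the program to the safety sets *)

Lemma soc_ball (R : realType) n (b : 'cV[R]_n) (e : R) (p : 'cV[R]_n) :
  soc 1%:M b 0 e p = (norm2 (p + b) <= e).
Proof. by rewrite /soc /= mul1mx dotpC dotp0r add0r. Qed.

(** A matrix without rows makes the norm side 0, so linear constraints are cone constraints too. *)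
Lemma soc_halfspace (R : realType) n (c : 'cV[R]_n) (e : R) (p : 'cV[R]_n) :
  soc (0 : 'M[R]_(0, n)) 0 c (- e) p = (e <= dotp c p).
Proof. by rewrite /soc /= [X in norm2 X]flatmx0 norm20 subr_ge0. Qed.

Lemma zctrlE (R : realType) (d N : nat) (tau : nat -> R)
    (P : 'M[R]_(3, N.+1)) r (j : 'I_(N.+1 + r)) :
  zctrl d tau P j = dotp (zW R) (ctrl d tau P j).
Proof.
by rewrite /ctrl dotp_sumr; apply: eq_bigr => i _; rewrite dotpZr mulrC.
Qed.

Theorem theorem1 (R : realType) (d N : nat) (tau : nat -> R)
    (D : flat_data R) (P : 'M[R]_(3, N.+1)) (zeta : 'rV[R]_(N - d).+1)
    (hd : (4 <= d)%N) (hN : (d <= N)%N)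
    (htau : clamped_uniform d N tau)
    (hD : flat_data_ok d D)
    (hfeas : flat_socp_feasible tau D P zeta) :
  let tau_v := tau (last_knot d N) in
  let J := [set t | tau 0%N <= t < tau_v] in
  let sigma := fun t : R => (bspline_curve d tau P t, 0 : R) in
  forall t : R, tau 0%N <= t < tau_v ->
    (Xp D `&` Xv D `&` Xxi D) (flat_state J (grav D) sigma t) /\
    (UT D `&` Uomega D) (flat_input J (grav D) sigma t).
Proof.
move=> tau_v J sigma t Jt.
pose Q j : 'cV[R]_3 := col (inord j) P.
pose S := spline d N tau Q.
have E0 s : J s -> (sigma s).1 = S 0%N s by exact: bspline_curveE.
(* Each derivative is identified on all of [J], because the next one differentiates it as a function
   on [J]. *)
have E1 s : J s -> deriv_on J (fun u => (sigma u).1) s = S 1%N s.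
  move=> Js; apply: etrans _ (deriv_on_spline htau hN Q _ Js); last by lia.
  by apply: eq_deriv_on => // u /set_mem; exact: E0.
set r1 := deriv_on J _ in E1.
have E2 s : J s -> deriv_on J r1 s = S 2%N s.
  move=> Js; apply: etrans _ (deriv_on_spline htau hN Q _ Js); last by lia.
  by apply: eq_deriv_on => // u /set_mem; exact: E1.
set r2 := deriv_on J _ in E2.
(* Differentiating [S 2] requires degree [d - 2] at least 2, which is [4 <= d]. *)
have E3 s : J s -> deriv_on J r2 s = S 3%N s.
  move=> Js; apply: etrans _ (deriv_on_spline htau hN Q _ Js); last by lia.
  by apply: eq_deriv_on => // u /set_mem; exact: E2.
set r3 := deriv_on J _ in E3.
have [l lN tl] := knots_locate htau hN Jt.
have con r m (A : 'M[R]_(m, 3)) b c e : (r <= d)%N ->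
    (forall j : 'I_(N.+1 + r), (r <= j <= N)%N -> (l - d + r <= j <= l)%N ->
      soc A b c e (ctrl d tau P j)) -> soc A b c e (S r t).
  move=> rd H; apply: (spline_soc hN htau rd lN tl) => j jN jl.
  have jN' : (j < N.+1 + r)%N by lia.
  by have := H (Ordinal jN') jN jl; rewrite ctrlE.
have pos : Kp D (S 0%N t).
  apply: con => // j jN _.
  have jN' : (j < N.+1)%N by lia.
  have := position_con hfeas (Ordinal jN').
  rewrite ctrlE//= (_ : inord j = Ordinal jN')//.
  by apply: val_inj; rewrite /= inordK.
have vel : norm2 (S 1%N t) <= vmax D.
  rewrite -[S 1%N t]addr0 -soc_ball; apply: con => [|j jN _]; first lia.
  by rewrite soc_ball addr0; apply: (velocity_con hfeas).
have angle : norm2 (Aeps D *m S 2 t) <= dotp (zW R) (S 2 t) + grav D.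
  rewrite -[X in norm2 X]addr0; apply: con => [|j jN _]; first lia.
  by rewrite /soc /= addr0 addrC -zctrlE; apply: (angle_con hfeas).
have thrust : norm2 (S 2 t + grav D *: zW R) <= Tmax D.
  rewrite -soc_ball; apply: con => [|j jN _]; first lia.
  by rewrite soc_ball; apply: (thrust_max_con hfeas).
have thrust_z : Tmin D - grav D <= dotp (zW R) (S 2 t).
  rewrite -soc_halfspace; apply: con => [|j jN _]; first lia.
  by rewrite soc_halfspace -zctrlE; apply: (thrust_min_con hfeas).
(* The slack variable of the knot span containing [t]: it bounds the vertical thrust from below and
   the jerk from above on the same span. *)
set ze := zeta 0 (inord (l - d)).
have acc : ze - grav D <= dotp (zW R) (S 2 t).
  rewrite -soc_halfspace; apply: con => [|j jN jl]; first lia.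
  by rewrite soc_halfspace -zctrlE; apply: (omega_acc_con hfeas) jl.
have jerk : norm2 (S 3 t) <= wmax D * ze.
  rewrite -[S 3 t]addr0 -soc_ball; apply: con => [|j jN jl]; first lia.
  by rewrite soc_ball addr0; apply: (omega_jerk_con hfeas) jl.
have ze_gt0 : 0 < ze := zeta_gt0 hfeas _.
pose T := Tvec J (grav D) sigma t.
have TE : T = S 2 t + grav D *: zW R by rewrite /T /Tvec -/r1 -/r2 E2.
have T0 : T 0 0 = S 2 t 0 0.
  by rewrite TE mxE [X in _ + X]mxE vec3E mulr0 addr0.
have T1 : T 1 0 = S 2 t 1 0.
  by rewrite TE mxE [X in _ + X]mxE vec3E mulr0 addr0.
have T2 : T 2%:R 0 = S 2 t 2%:R 0 + grav D.
  by rewrite TE mxE [X in _ + X]mxE vec3E mulr1.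
rewrite dotp_zW in angle; rewrite !dotp_zW in thrust_z acc.
rewrite Aeps_norm -T0 -T1 -T2 in angle.
have T2_ge : ze <= T 2%:R 0 by rewrite T2; lra.
have T2_gt0 : 0 < T 2%:R 0 by lra.
have T2_le : T 2%:R 0 <= norm2 T.
  rewrite -ler_sqr ?nnegrE ?norm2_ge0 ?(ltW T2_gt0)// norm2_ord3_sqr.
  by rewrite lerDr addr_ge0 ?sqr_ge0.
have n_gt0 : 0 < norm2 T by lra.
have ha : 0 < eps D < pi / 2 by rewrite (eps_gt0 hD) (eps_lt hD).
have sa : 0 < sin (eps D).
  by case/andP: ha => ? ?; apply: sin_gt0_pi; have := pi_gt0 R; lra.
have ca : 0 < cos (eps D) by case/andP: ha => ? ?; apply: cos_gt0_pihalf; lra.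
pose z := zB J (grav D) sigma t.
have zE : z = (norm2 T)^-1 *: T by [].
have nz : norm2 z = 1.
  by rewrite zE norm2Z gtr0_norm ?invr_gt0// mulVf// lt0r_neq0.
have z2_gt0 : 0 < z 2%:R 0 by rewrite zE mxE mulr_gt0 ?invr_gt0.
(* The squared angle constraint is homogeneous in [T], so it passes to the unit vector [z]. *)
have cone : cos (eps D) ^+ 2 * (z 0 0 ^+ 2 + z 1 0 ^+ 2)
    <= sin (eps D) ^+ 2 * z 2%:R 0 ^+ 2.
  have : (`|cot (eps D)| * Num.sqrt (T 0 0 ^+ 2 + T 1 0 ^+ 2)) ^+ 2
      <= T 2%:R 0 ^+ 2.
    by rewrite ler_sqr ?nnegrE ?mulr_ge0 ?sqrtr_ge0// ltW.
  rewrite exprMn sqr_sqrtr ?addr_ge0 ?sqr_ge0// real_normK ?num_real//.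
  rewrite /cot expr_div_n mulrAC ler_pdivrMr ?exprn_gt0// => H.
  have zi i : z i 0 = (norm2 T)^-1 * T i 0 by rewrite zE mxE.
  rewrite !zi !exprMn -!mulrDr mulrCA [leRHS]mulrCA.
  rewrite ler_pM2l; last by rewrite exprn_gt0 ?invr_gt0.
  by rewrite [leRHS]mulrC.
have [nx ny pitch roll] := flat_frame nz z2_gt0 ha cone.
have yCE : yC sigma t = vec3 0 1 0 by rewrite /yC /= sin0 cos0 oppr0.
have xE : xB J (grav D) sigma t
    = (norm2 (crossp (vec3 0 1 0) z))^-1 *: crossp (vec3 0 1 0) z.
  by rewrite /xB yCE.
have yE : yB J (grav D) sigma t = crossp z (xB J (grav D) sigma t) by [].
rewrite -xE -yE in nx ny pitch roll.
(* Projecting orthogonally to [z] does not lengthen the jerk, which is at most [wmax D * ze], while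
   [ze <= norm2 T]. *)
have h_le : norm2 (homega J (grav D) sigma t) <= wmax D.
  rewrite /homega -/T -/z norm2Z gtr0_norm ?invr_gt0// mulrC ler_pdivrMr//.
  apply: le_trans (perp_le _ nz) _; rewrite -/r1 -/r2 -/r3 E3//.
  apply: le_trans jerk _; rewrite ler_pM2l ?(wmax_gt0 hD)//; lra.
have rate u : norm2 u = 1 -> `|dotp u (homega J (grav D) sigma t)| <= wmax D.
  by move=> u1; apply: le_trans (dotp_le _ _) _; rewrite u1 mul1r.
split; [split; [split|]|split].
- rewrite -(E0 t Jt) in pos; exact: pos.
- rewrite -(E1 t Jt) in vel; exact: vel.
- by split; rewrite /= ?normrN.
- rewrite /UT /= -/r1 -/r2 E2// -T0 -T1 -T2 -norm2_ord3 TE thrust andbT -TE.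
  by apply: le_trans T2_le; rewrite T2; lra.
- by split; rewrite /= ?normrN; apply: rate.
Qed.
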